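(* In the additive growth curve model $Y_n=\sum_{i=1}^kX_i\Theta_iZ_i'+\mathcal E$ with orthogonal design matrices (as specified in the context), suppose that for each $l=1,\dots,k$ $$\lim_{n\to\infty}n^{-1}X_l'X_l=R_l,$$ where $R_l$ is positive definite. Then, for any fixed $i\in\{1,\dots,k\}$, the statistic $$\widehat\Theta_i(Y_n)=(X_i'X_i)^{-1}X_i'\,Y_n\,H_i(Y_n)\,Z_i(Z_i'Z_i)^{-1}$$ is a consistent estimator of the regression coefficient $\Theta_i$; that is, $\widehat\Theta_i(Y_n)$ converges in probability to $\Theta_i$ as $n\to\infty$.
   Context: Model. For each sample size $n$, $Y_n$ is an $n\times p$ random matrix of observations with $Y_n=\sum_{i=1}^kX_i\Theta_iZ_i'+\mathcal E$. For $1\le i\le k$, $X_i$ (depending on $n$) is a known $n\times m_i$ design matrix ($n>m_i$) of full rank $m_i$, $Z_i$ is a known $p\times q_i$ profile matrix ($p>q_i$) of full rank $q_i$, and $\Theta_i$ is an unknown $m_i\times q_i$ matrix of regression coefficients; $k,p,m_i,q_i,Z_i,\Theta_i$ do not depend on $n$. The $n\times p$ error matrix $\mathcal E$ (depending on $n$) has a general continuous type distribution; its rows are independent and identically distributed with mean zero and common unknown positive definite $p\times p$ covariance matrix $\Sigma$. The design matrices satisfy $\operatorname{rank}(X_i)+p\le n$ for all $i$ and $X_i'X_j=\mathbf 0$ for all distinct $i,j$. As $n$ grows, new rows are added to the matrices $X_i$ (and to $Y_n,\mathcal E$), earlier rows remaining intact. Notation. $A'$ is the transpose, $A^+$ the Moore-Penrose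 inverse, $P_A=A(A'A)^-A'$ the orthogonal projection onto the column space of $A$. Quadratic estimator. $\widehat\Sigma(Y_n)=Y_n'WY_n$, $W=\frac1r\bigl(I-\sum_{i=1}^kP_{X_i}\bigr)$, $r=n-\sum_{i=1}^k\operatorname{rank}(X_i)$. The paper takes $\widehat\Sigma(Y_n)$ to be positive definite with probability one, so its inverse $\widehat\Sigma^{-1}(Y_n)$ exists with probability one. $H_i(Y_n)=\widehat\Sigma^{-1}(Y_n)Z_i\bigl(Z_i'\widehat\Sigma^{-1}(Y_n)Z_i\bigr)^{-1}Z_i'$. *)

(* Defs.v *)
From HB Require Import structures.
From mathcomp Require Import all_boot all_order all_algebra finmap.
From mathcomp Require Import all_classical all_reals all_analysis.

Set Implicit Arguments.
Unset Strict Implicit.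
Unset Printing Implicit Defensive.

Import Order.TTheory GRing.Theory Num.Theory.
Import numFieldNormedType.Exports.

Local Open Scope classical_set_scope.
Local Open Scope ring_scope.

Definition posdefmx (R : realType) (s : nat) (A : 'M[R]_s) : Prop :=
  A^T = A /\ forall v : 'cV[R]_s, v != 0 -> 0 < (v^T *m A *m v) 0 0.

(* [A (A'A)^- A'], the generalized inverse being [pinvmx (A'A)]: it satisfies
   [B *m pinvmx B *m B = B], see [mulmxKpV]. *)
Definition orth_proj (R : realType) (s c : nat) (A : 'M[R]_(s, c)) : 'M[R]_s :=
  A *m pinvmx (A^T *m A) *m A^T.

Section Random.
Context (R : realType) (d : measure_display) (T : measurableType d).
Variable P : probability T R.

Definition mutually_independent (s : nat) (e : nat -> {RV P >-> s.-tuple R}) :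
    Prop :=
  forall (J : {fset nat}) (A : nat -> set (s.-tuple R)),
    (forall j, measurable (A j)) ->
    P (\bigcap_(j in [set` J]) (e j @^-1` A j)) =
    (\prod_(j <- J) P (e j @^-1` A j))%E.

(* Equality is required on measurable sets only, since [distribution P (e j)]
   is a function on all sets. *)
Definition identically_distributed (s : nat)
    (e : nat -> {RV P >-> s.-tuple R}) : Prop :=
  forall (j j' : nat) (A : set (s.-tuple R)), measurable A ->
    distribution P (e j) A = distribution P (e j') A.

Definition mean_cov (s : nat) (X : {RV P >-> s.-tuple R}) (mu : 'rV[R]_s)
    (Sigma : 'M[R]_s) : Prop :=
  [/\ forall a : 'I_s, (fun t => tnth (X t) a) \in Lfun P 2%:E,
      forall a : 'I_s, ('E_P[fun t => tnth (X t) a] = (mu 0 a)%:E)%E &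
      forall a b : 'I_s,
        covariance P (fun t => tnth (X t) a) (fun t => tnth (X t) b)
        = (Sigma a b)%:E].

(* The integral of [g] against the Lebesgue measure of R^s, as the iterated
   integral [\int dv_1 ... \int dv_s g(v_1, ..., v_s)]; it is used below on
   nonnegative Borel functions, where the order of integration is immaterial. *)
Fixpoint iterated_integral (s : nat) : (s.-tuple R -> \bar R) -> \bar R :=
  match s with
  | 0 => fun g => g [tuple]
  | s'.+1 => fun g =>
      (\int[lebesgue_measure]_x
         iterated_integral (fun v : s'.-tuple R => g [tuple of x :: v]))%E
  end.

(* The distribution has a density with respect to the Lebesgue measure of
   R^(s1 * s2), the entries of the matrix being listed in the order of
   [mxvec]. *)
Definition continuous_type (s1 s2 : nat) (X : T -> 'M[R]_(s1, s2)) : Prop :=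
  exists f : (s1 * s2).-tuple R -> R,
    [/\ measurable_fun setT f, forall v, 0 <= f v &
        forall A : set ((s1 * s2).-tuple R), measurable A ->
          P [set t | A [tuple mxvec (X t) 0 i | i < s1 * s2]] =
          iterated_integral (fun v => (f v * \1_A v)%:E)].

(* [`| _ |] is the entrywise maximum norm of matrices. *)
Definition cvg_in_probability (s1 s2 : nat) (X : nat -> T -> 'M[R]_(s1, s2))
    (L : 'M[R]_(s1, s2)) : Prop :=
  forall eps : R, 0 < eps ->
    P [set t | eps <= `|X n t - L|] @[n --> \oo] --> 0%E.

End Random.

Section GrowthCurve.
Context (R : realType) (k p : nat) (m q : 'I_k -> nat).
(* [x i j] is the [j]-th row of the [i]-th design matrix: the design matrix for
   sample size [n] consists of the first [n] rows, so that increasing [n] adds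
   rows and leaves the earlier ones unchanged. The same holds for [e], the
   sequence of the rows of the errors. *)
Variable x : forall i : 'I_k, nat -> 'rV[R]_(m i).
Variable Z : forall i : 'I_k, 'M[R]_(p, q i).
Variable Theta : forall i : 'I_k, 'M[R]_(m i, q i).

Definition design (i : 'I_k) (n : nat) : 'M[R]_(n, m i) :=
  \matrix_(j < n) x i j.

Definition errors (T : Type) (e : nat -> T -> p.-tuple R) (n : nat) (t : T) :
    'M[R]_(n, p) :=
  \matrix_(j < n, a < p) tnth (e j t) a.

Definition observations (T : Type) (e : nat -> T -> p.-tuple R) (n : nat)
    (t : T) : 'M[R]_(n, p) :=
  \sum_(i < k) design i n *m Theta i *m (Z i)^T + errors e n t.

Definition resid_df (n : nat) : R :=
  n%:R - \sum_(i < k) (\rank (design i n))%:R.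

Definition Wmx (n : nat) : 'M[R]_n :=
  (resid_df n)^-1 *: (1%:M - \sum_(i < k) orth_proj (design i n)).

Definition Sigma_hat (n : nat) (Y : 'M[R]_(n, p)) : 'M[R]_p :=
  Y^T *m Wmx n *m Y.

Definition Hmx (i : 'I_k) (n : nat) (Y : 'M[R]_(n, p)) : 'M[R]_p :=
  invmx (Sigma_hat Y) *m Z i
  *m invmx ((Z i)^T *m invmx (Sigma_hat Y) *m Z i) *m (Z i)^T.

Definition Theta_hat (i : 'I_k) (n : nat) (Y : 'M[R]_(n, p)) :
    'M[R]_(m i, q i) :=
  invmx ((design i n)^T *m design i n) *m (design i n)^T
  *m Y *m Hmx i Y *m Z i *m invmx ((Z i)^T *m Z i).

End GrowthCurve.

(* Main.v *)
Require Import Defs.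
From HB Require Import structures.
From mathcomp Require Import all_boot all_order all_algebra finmap.
From mathcomp Require Import all_classical all_reals all_analysis.
From mathcomp Require Import measurable_realfun.
From mathcomp Require Import ring lra.

(** Write [S] for the residual covariance estimator, [D_l = (X_l'X_l)^-1 X_l']
for the least-squares operator of the [l]-th design, [E] for the error matrix
and [G = S^-1 Z_i (Z_i' S^-1 Z_i)^-1] for the generalized least-squares weights
built from [S]. Orthogonality of the designs and the identity [Z_i' G = I] make
the estimation error exactly [D_i E G] wherever [S] is positive definite
([estimation_error]). The factor [D_i E] has entries of variance [O(1/n)], so
it tends to 0 in probability; what has to be excluded is that the random weights
[G] blow up.

Two observations control [G]. First, for every vector [u], [G u] minimizes the
quadratic form of [S] among the solutions [g] of [Z_i' g = u]
([gls_minimal]); comparing with the ordinary least-squares weights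
[Z_i (Z_i' Z_i)^-1] bounds [G] by the ratio of an upper bound of [S] to a lower
bound of [S] ([sqnorm_gls_le]). The upper bound, of the order of the mean of the
squared errors, follows from Markov's inequality. Secondly, the lower bound
uses that multiplying the rank one matrices [e_j' e_j] by the weights
[1 / (1 + |e_j|^2)], which are at most 1, can only decrease their average: the
weighted entries are bounded, so Chebyshev's inequality applies to them
although the errors have only second moments. Their common expectation [shrunk_cov] is still
positive definite ([shrunk_cov_posdef]), hence [E'E / n] is bounded below with
probability tending to 1 ([whp_errors_coercive]). The matrix [S] differs from
[E'E / r] by terms built from the [D_l E], which vanish in the limit
([qform_resid], [Sigma_hat_coercive]).

The product of the bounds on [D_i E] and on [S] is handled by letting them vary
with [n]: with probability tending to 1, the squared norm of [D_i E] is at most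
[s / sqrt n] for any fixed [s > 0], while the mean of the squared errors is at
most [sqrt n] ([whp_frob2_lincomb], [whp_frob2_errors]). *)

Set Implicit Arguments.
Unset Strict Implicit.
Unset Printing Implicit Defensive.

Import Order.TTheory GRing.Theory Num.Theory.
Import numFieldNormedType.Exports.

Local Open Scope classical_set_scope.
Local Open Scope ring_scope.

(** * Moments of independent random variables *)

Section Moments.
Context (R : realType) (d : measure_display) (T : measurableType d).
Variable P : probability T R.

Lemma Lfun2_Lfun1 (X : T -> R) : X \in Lfun P 2%:E -> X \in Lfun P 1.
Proof. by move=> X2; apply: (Lfun_subset12 _ X2); rewrite fin_num_measure. Qed.

Lemma Lfun_measurable (X : T -> R) r : X \in Lfun P r -> measurable_fun setT X.
Proof. by rewrite inE => /andP[+ _]; rewrite inE. Qed.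

(** The product rule on events identifies the joint law of [X] and [Y] with the
product of their laws, and Fubini's theorem does the rest. *)
Lemma expectation_indepM (X Y : {RV P >-> R}) :
    (forall A B, measurable A -> measurable B ->
       P (X @^-1` A `&` Y @^-1` B) = (P (X @^-1` A) * P (Y @^-1` B))%E) ->
    (X : T -> R) \in Lfun P 2%:E -> (Y : T -> R) \in Lfun P 2%:E ->
  ('E_P[X \* Y] = 'E_P[X] * 'E_P[Y])%E.
Proof.
move=> XY X2 Y2.
have X1 := Lfun2_Lfun1 X2; have Y1 := Lfun2_Lfun1 Y2.
have XY1 := Lfun2_mul_Lfun1 X2 Y2.
pose h t := (X t, Y t).
have mh : measurable_fun [set: T] h by apply/measurable_fun_pairP; split.
pose f (z : R * R) := (z.1 * z.2)%:E.
have mf : measurable_fun [set: (R * R)%type] f.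
  apply/measurable_EFinP/measurable_funM; first exact: measurable_fst.
  exact: measurable_snd.
pose PX := distribution P X; pose PY := distribution P Y.
pose H : {RV P >-> (R * R)%type} :=
  HB.pack h (isMeasurableFun.Build _ _ _ _ _ mh).
pose mm := distribution P H.
have prodE A : measurable A -> (PX \x PY)%E A = mm A.
  apply: (product_measure_unique (m1 := PX) (m2 := PY)) => B C mB mC.
  exact: XY.
have fi : P.-integrable setT (f \o h) by apply/Lfun1_integrable.
have fi' : (PX \x PY)%E.-integrable setT f.
  apply/integrableP; split => //.
  rewrite (eq_measure_integral mm); last by move=> A mA _; exact: prodE.
  by have /integrableP[] := integrable_pushforward mh mf fi measurableT.
have EX : (\int[PX]_x x%:E = 'E_P[X])%E.
  rewrite integral_distribution//.
    by rewrite unlock.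
  exact/Lfun1_integrable.
have EY : (\int[PY]_x x%:E = 'E_P[Y])%E.
  rewrite integral_distribution//.
    by rewrite unlock.
  exact/Lfun1_integrable.
transitivity (\int[(PX \x PY)]_z f z)%E.
  rewrite (eq_measure_integral mm); last by move=> A mA _; exact: prodE.
  by rewrite integral_distribution// unlock.
rewrite -integral12_prod_meas1//= /fubini_F /f/=.
have iY : PY.-integrable setT (EFin : R -> \bar R).
  by apply: integrable_pushforward => //; exact/Lfun1_integrable.
have iX : PX.-integrable setT (EFin : R -> \bar R).
  by apply: integrable_pushforward => //; exact/Lfun1_integrable.
under eq_integral => x _.
  under eq_integral => y _ do rewrite EFinM.
  rewrite integralZl//= EY.
  over.
rewrite /=.
rewrite -(fineK (expectation_fin_num Y1)).
rewrite integralZr//.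
by rewrite EX.
Qed.

Lemma covariance_indep (X Y : {RV P >-> R}) :
    (forall A B, measurable A -> measurable B ->
       P (X @^-1` A `&` Y @^-1` B) = (P (X @^-1` A) * P (Y @^-1` B))%E) ->
    (X : T -> R) \in Lfun P 2%:E -> (Y : T -> R) \in Lfun P 2%:E ->
  covariance P X Y = 0%E.
Proof.
move=> XY X2 Y2.
rewrite covarianceE ?Lfun2_mul_Lfun1 ?Lfun2_Lfun1//.
rewrite [X in (X - _)%E](expectation_indepM XY X2 Y2) subee//.
by rewrite fin_numM// expectation_fin_num// Lfun2_Lfun1.
Qed.

Lemma expectation_lincomb (I : eqType) (Y : I -> T -> R) (c mu : I -> R) s :
    (forall i, Y i \in Lfun P 1) -> (forall i, 'E_P[Y i] = (mu i)%:E)%E ->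
  ('E_P[fun t => (\sum_(i <- s) c i * Y i t)%R] =
   (\sum_(i <- s) c i * mu i)%:E)%E.
Proof.
move=> Y1 Ymu.
suff [] : (fun t => \sum_(i <- s) c i * Y i t) \in Lfun P 1 /\
  ('E_P[fun t => (\sum_(i <- s) c i * Y i t)%R] =
   (\sum_(i <- s) c i * mu i)%:E)%E by [].
elim: s => [|i s [IH1 IH]].
  rewrite (_ : (fun=> _) = cst 0); last by apply/funext => t; rewrite big_nil.
  by rewrite expectation_cst big_nil Lfun_cst.
have -> : (fun t => \sum_(j <- i :: s) c j * Y j t) =
    c i \o* Y i \+ (fun t => \sum_(j <- s) c j * Y j t).
  by apply/funext => t; rewrite big_cons/= [c i * _]mulrC.
have cY : c i \o* Y i \in Lfun P 1 by rewrite Lfun_scale.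
split; first by rewrite rpredD.
by rewrite expectationD// expectationZl// IH Ymu big_cons EFinD EFinM.
Qed.

Section Uncorrelated.
Context (I : eqType) (Y : I -> T -> R) (c : I -> R) (V : R).
Hypothesis Y2 : forall i, Y i \in Lfun P 2%:E.
Hypothesis Y0 : forall i j, i != j -> covariance P (Y i) (Y j) = 0%E.
Hypothesis YV : forall i, ('V_P[Y i] <= V%:E)%E.

Let comb s t := \sum_(i <- s) c i * Y i t.

Let comb_cons i s : comb (i :: s) = c i \o* Y i \+ comb s.
Proof. by apply/funext => t; rewrite /comb big_cons/= [c i * _]mulrC. Qed.

Lemma lincomb_Lfun2 s : comb s \in Lfun P 2%:E.
Proof.
elim: s => [|i s IH].
  rewrite (_ : comb _ = cst 0) ?Lfun_cst//.
  by apply/funext => t; rewrite /comb big_nil.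
by rewrite comb_cons rpredD ?Lfun_scale ?lee1n//= => _; rewrite Lfun_scale ?ler1n.
Qed.

Lemma covariance_lincomb i s : i \notin s -> covariance P (Y i) (comb s) = 0%E.
Proof.
elim: s => [|j s IH].
  rewrite (_ : comb _ = cst 0) ?covariance_cst_r//.
  by apply/funext => t; rewrite /comb big_nil.
rewrite inE negb_or => /andP[ij /IH is0].
rewrite comb_cons covarianceDr ?lincomb_Lfun2 ?Lfun_scale ?ler1n//= is0.
by rewrite covarianceZr ?Lfun2_mul_Lfun1 ?Lfun2_Lfun1// Y0// mule0 add0e.
Qed.

(** Uncorrelated summands: the variances add up. *)
Lemma variance_lincomb s : uniq s ->
  ('V_P[comb s] <= (V * \sum_(i <- s) c i ^+ 2)%:E)%E.
Proof.
elim: s => [_|i s IH /= /andP[iNs us]].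
  rewrite (_ : comb _ = cst 0) ?variance_cst ?big_nil ?mulr0//.
  by apply/funext => t; rewrite /comb big_nil.
rewrite comb_cons varianceD ?lincomb_Lfun2 ?Lfun_scale ?ler1n//=.
rewrite covarianceZl ?Lfun2_mul_Lfun1 ?Lfun2_Lfun1 ?lincomb_Lfun2//.
rewrite covariance_lincomb// !mule0 adde0 big_cons mulrDr EFinD leeD ?IH//.
by rewrite varianceZ// (mulrC V) [in leRHS]EFinM lee_wpmul2l// lee_fin sqr_ge0.
Qed.

Lemma chebyshev_lincomb mu s eps : uniq s -> 0 < eps ->
    (forall i, 'E_P[Y i] = (mu i)%:E)%E ->
  (P [set t | (eps <= `|comb s t - \sum_(i <- s) c i * mu i|)%R] <=
   (V * (\sum_(i <- s) c i ^+ 2) / eps ^+ 2)%:E)%E.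
Proof.
move=> us eps0 Ymu.
have mS : measurable_fun setT (comb s) := Lfun_measurable (lincomb_Lfun2 s).
pose S : {RV P >-> R} := HB.pack (comb s) (isMeasurableFun.Build _ _ _ _ _ mS).
have := @chebyshev _ _ _ P S _ eps0.
rewrite (expectation_lincomb _ _ (fun i => Lfun2_Lfun1 (Y2 i)) Ymu) /= => /le_trans; apply.
rewrite mulrC [in leRHS]EFinM lee_wpmul2l//; first by rewrite lee_fin invr_ge0 sqr_ge0.
exact: variance_lincomb.
Qed.

End Uncorrelated.

Lemma markov_ge0 (X : T -> R) (eps : R) : 0 < eps -> measurable_fun setT X ->
    (forall t, 0 <= X t) ->
  (P [set t | (eps <= X t)%R] <= (eps^-1)%:E * 'E_P[X])%E.
Proof.
move=> eps0 mX X0.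
pose S : {RV P >-> R} := HB.pack X (isMeasurableFun.Build _ _ _ _ _ mX).
have := @markov _ _ _ P S id eps eps0 (@measurable_id _ _ _) (fun r h => h)
  (fun _ _ _ _ h => h).
rewrite (_ : id \o _ \o _ = X); last first.
  by apply/funext => t /=; rewrite ger0_norm.
rewrite (_ : [set _ | _] = [set t | eps <= X t]); last first.
  by apply/seteqP; split => t /=; rewrite lee_fin ger0_norm.
by move=> h; rewrite -lee_pdivrMl ?invr_gt0// invrK.
Qed.

(** On a probability space boundedness gives all moments; this is what makes
Chebyshev's inequality available for the shrunk products of error entries. *)
Lemma bounded_Lfun2 (X : T -> R) M : measurable_fun setT X ->
  (forall t, `|X t| <= M) -> X \in Lfun P 2%:E.
Proof.
move=> mX XM; rewrite inE/=; apply/andP; split; rewrite inE//=.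
rewrite /finite_norm unlock poweR_lty//.
apply: (@le_lt_trans _ _ (\int[P]_x (M `^ 2)%:E)%E).
  apply: ge0_le_integral => //=.
  - apply/measurable_EFinP; apply: (measurableT_comp (measurable_powR _)) => //.
    exact: measurableT_comp.
  - by move=> t _; rewrite lee_fin ge0_ler_powR ?nnegrE// (le_trans _ (XM t)).
by apply: integrable_lty => //; exact: finite_measure_integrable_cst.
Qed.

Lemma bounded_variance_le1 (X : T -> R) : measurable_fun setT X ->
  (forall t, `|X t| <= 1) -> ('V_P[X] <= 1)%E.
Proof.
move=> mX X1; have X2 := bounded_Lfun2 mX X1.
rewrite varianceE//; apply: (@le_trans _ _ 'E_P[X ^+ 2]%E).
  by rewrite leeBlDr ?fin_numX ?expectation_fin_num ?Lfun2_Lfun1// leeDl// sqre_ge0.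
rewrite -(expectation_cst P 1); apply: expectation_le => //.
- exact: (measurable_funX 2 mX).
- by move=> t; exact: sqr_ge0.
- by apply: aeW => t; rewrite -[leLHS]/(X t ^+ 2) -real_normK ?num_real// expr_le1.
Qed.

End Moments.

(** * Quadratic forms and positive definiteness *)

Section QuadraticForms.
Variable R : realFieldType.

Definition qform s (A : 'M[R]_s) (v : 'cV[R]_s) : R := (v^T *m A *m v) 0 0.

Definition sqnorm s (v : 'cV[R]_s) : R := \sum_a v a 0 ^+ 2.

(** Positive definiteness with an explicit margin [c], which survives small
perturbations of the entries. *)
Definition coercive s (c : R) (A : 'M[R]_s) :=
  forall v, c * sqnorm v <= qform A v.

Lemma sqnorm_ge0 s (v : 'cV[R]_s) : 0 <= sqnorm v.
Proof. by apply: sumr_ge0 => a _; exact: sqr_ge0. Qed.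

Lemma sqnorm_gt0 s (v : 'cV[R]_s) : v != 0 -> 0 < sqnorm v.
Proof.
move=> v0; rewrite lt_def sqnorm_ge0 andbT; apply: contra v0.
rewrite psumr_eq0 => [/allP v0|a _]; last exact: sqr_ge0.
apply/eqP/colP => a; rewrite mxE; apply/eqP.
by have := v0 a (mem_index_enum _); rewrite sqrf_eq0.
Qed.

Lemma sqnormE s (v : 'cV[R]_s) : sqnorm v = (v^T *m v) 0 0.
Proof. by rewrite mxE; apply: eq_bigr => a _; rewrite mxE expr2. Qed.

Lemma qformE s (A : 'M[R]_s) v :
  qform A v = \sum_a \sum_b v a 0 * A a b * v b 0.
Proof.
rewrite /qform mxE exchange_big; apply: eq_bigr => b _ /=.
by rewrite mxE mulr_suml; apply: eq_bigr => a _; rewrite !mxE.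
Qed.

Lemma qformB s (A B : 'M[R]_s) v : qform (A - B) v = qform A v - qform B v.
Proof. by rewrite /qform mulmxBr mulmxBl !mxE. Qed.

Lemma qformZ s k (A : 'M[R]_s) v : qform (k *: A) v = k * qform A v.
Proof. by rewrite /qform -scalemxAr -scalemxAl mxE. Qed.

Lemma qform_sum s (I : finType) (A : I -> 'M[R]_s) v :
  qform (\sum_i A i) v = \sum_i qform (A i) v.
Proof. by rewrite /qform mulmx_sumr mulmx_suml summxE. Qed.

Lemma qform_congr s n (A : 'M[R]_n) (B : 'M[R]_(n, s)) v :
  qform (B^T *m A *m B) v = qform A (B *m v).
Proof. by rewrite /qform trmx_mul !mulmxA. Qed.

Lemma qform_gram s n (B : 'M[R]_(n, s)) v : qform (B^T *m B) v = sqnorm (B *m v).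
Proof. by rewrite sqnormE /qform trmx_mul !mulmxA. Qed.

(** Lagrange's identity: the difference of the two sides is half the sum of the
squares of the [x i * y j - x j * y i]. *)
Lemma cauchy_schwarz (I : finType) (x y : I -> R) :
  (\sum_i x i * y i) ^+ 2 <= (\sum_i x i ^+ 2) * (\sum_i y i ^+ 2).
Proof.
have : 0 <= \sum_i \sum_j (x i * y j - x j * y i) ^+ 2.
  by apply: sumr_ge0 => i _; apply: sumr_ge0 => j _; exact: sqr_ge0.
suff -> : \sum_i \sum_j (x i * y j - x j * y i) ^+ 2 =
    2 * ((\sum_i x i ^+ 2) * (\sum_i y i ^+ 2) - (\sum_i x i * y i) ^+ 2).
  by rewrite pmulr_rge0 ?subr_ge0.
transitivity (\sum_i \sum_j (x i ^+ 2 * y j ^+ 2 + y i ^+ 2 * x j ^+ 2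
    - 2 * ((x i * y i) * (x j * y j)))).
  by apply: eq_bigr => i _; apply: eq_bigr => j _; ring.
under eq_bigr do rewrite sumrB big_split/= -!mulr_sumr.
rewrite sumrB big_split/= -!mulr_suml -mulr_sumr -mulr_suml.
ring.
Qed.

Lemma qform_entries_le s (A : 'M[R]_s) delta v :
  (forall a b, `|A a b| <= delta) -> `|qform A v| <= s%:R * delta * sqnorm v.
Proof.
move=> Ad; rewrite qformE.
apply: (@le_trans _ _ (\sum_(a < s) \sum_(b < s)
    (delta / 2 * v a 0 ^+ 2 + delta / 2 * v b 0 ^+ 2))).
  apply: le_trans (ler_norm_sum _ _ _) _; apply: ler_sum => a _.
  apply: le_trans (ler_norm_sum _ _ _) _; apply: ler_sum => b _.
  have d0 : 0 <= delta by apply: le_trans (Ad a b).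
  rewrite !normrM mulrAC [X in X <= _]mulrC.
  apply: le_trans (ler_wpM2r _ (Ad a b)) _; first exact: mulr_ge0.
  rewrite -mulrDr -[X in _ <= X]mulrA ler_wpM2l//.
  rewrite -(real_normK (num_real (v a 0))) -(real_normK (num_real (v b 0))).
  have := sqr_ge0 (`|v a 0| - `|v b 0|); nra.
under eq_bigr do rewrite big_split/= sumr_const card_ord -mulr_sumr -/(sqnorm v).
rewrite big_split/= sumr_const card_ord sumrMnl -mulr_sumr -/(sqnorm v).
by rewrite -mulrnDl -mulrDl -splitr -mulrA mulr_natl.
Qed.

Lemma posform_unit s (A : 'M[R]_s) :
  (forall v, v != 0 -> 0 < qform A v) -> A \in unitmx.
Proof.
move=> Apos; rewrite -unitmx_tr -row_free_unit -kermx_eq0.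
apply/eqP/row_matrixP => i; rewrite row0; apply/eqP; apply: contraT => ki0.
have : 0 < qform A (row i (kermx A^T))^T by apply: Apos; rewrite trmx_eq0.
have -> : qform A (row i (kermx A^T))^T = 0; last by rewrite ltxx.
rewrite /qform trmxK -mulmxA -[A *m _]trmxK trmx_mul trmxK.
have -> : row i (kermx A^T) *m A^T = 0 by rewrite -row_mul mulmx_ker row0.
by rewrite trmx0 mulmx0 mxE.
Qed.

Lemma coercive_gt0 s c (A : 'M[R]_s) v :
  0 < c -> coercive c A -> v != 0 -> 0 < qform A v.
Proof.
by move=> c0 Ac v0; apply: lt_le_trans (Ac v); rewrite mulr_gt0// sqnorm_gt0.
Qed.

Lemma coercive_unit s c (A : 'M[R]_s) : 0 < c -> coercive c A -> A \in unitmx.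
Proof. by move=> c0 Ac; apply: posform_unit => v; exact: (coercive_gt0 c0 Ac). Qed.

Lemma coercive_perturb s c delta (A B : 'M[R]_s) : coercive c A ->
  (forall a b, `|B a b - A a b| <= delta) -> coercive (c - s%:R * delta) B.
Proof.
move=> Ac BA v; have := Ac v.
have := @qform_entries_le s (B - A) delta v.
rewrite qformB mulrBl ler_norml => /(_ _)/andP[a b|h _]; first by rewrite !mxE.
by move: h; lra.
Qed.

(** With [u] the [a]-th column of the inverse, [qform A u = u a] and
[u a ^ 2 <= sqnorm u]; coercivity turns this into [c * u a ^ 2 <= u a]. *)
Lemma invmx_diag_le s c (A : 'M[R]_s) a : 0 < c -> coercive c A ->
  invmx A a a <= c^-1.
Proof.
move=> c0 Ac; have Au := coercive_unit c0 Ac.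
pose u := col a (invmx A).
have Au1 : A *m u = delta_mx a 0.
  by rewrite /u colE mulmxA mulmxV// mul1mx.
have qu : qform A u = u a 0.
  rewrite /qform -mulmxA Au1 mxE (bigD1 a)//= big1 => [|b ba].
    by rewrite !mxE !eqxx mulr1 addr0.
  by rewrite !mxE (negbTE ba) mulr0.
have := Ac u; rewrite qu.
have -> : invmx A a a = u a 0 by rewrite mxE.
move=> cu; have uu : u a 0 ^+ 2 <= sqnorm u.
  rewrite /sqnorm (bigD1 a)//= lerDl.
  by apply: sumr_ge0 => b _; exact: sqr_ge0.
rewrite -(ler_pM2l c0) divff ?gt_eqF//.
have [u0|u0] := lerP (u a 0) 0; first by rewrite (le_trans _ ler01)// pmulr_rle0.
by rewrite -(ler_pM2r u0) mul1r -mulrA -expr2 (le_trans _ cu)// ler_pM2l.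
Qed.

Lemma full_rank_mul_neq0 n s (Z : 'M[R]_(n, s)) (v : 'cV[R]_s) :
  \rank Z = s -> v != 0 -> Z *m v != 0.
Proof.
move=> rZ; apply: contra => /eqP/(congr1 trmx); rewrite trmx_mul trmx0 => /eqP.
by rewrite mulmx_free_eq0 ?trmx_eq0// /row_free mxrank_tr rZ.
Qed.

(** Gauss-Markov: for the weights [g] on the left, [S g] lies in the range of
[Z], so the difference of [g] and any other solution [g0] of [Z' g0 = u] is
[S]-orthogonal to [g], and the quadratic form splits by Pythagoras. *)
Lemma gls_minimal n s (S : 'M[R]_n) (Z : 'M[R]_(n, s)) (u : 'cV[R]_s) g0 :
    S^T = S -> S \in unitmx -> (forall v, 0 <= qform S v) ->
    Z^T *m invmx S *m Z \in unitmx -> Z^T *m g0 = u ->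
  qform S (invmx S *m Z *m invmx (Z^T *m invmx S *m Z) *m u) <= qform S g0.
Proof.
move=> St Su S0 Mu Zg0.
set M := Z^T *m _ *m _ in Mu *.
set g := _ *m u.
have Sg : S *m g = Z *m invmx M *m u by rewrite /g !mulmxA mulmxV// mul1mx.
have Zg : Z^T *m g = u by rewrite /g !mulmxA -/M mulmxV// mul1mx.
clearbody g.
have hSg : (g0 - g)^T *m S *m g = 0.
  rewrite -mulmxA Sg !mulmxA -[(g0 - g)^T *m Z]trmxK trmx_mul trmxK.
  by rewrite mulmxBr Zg0 Zg subrr trmx0 !mul0mx.
have gSh : g^T *m S *m (g0 - g) = 0.
  rewrite -[LHS]trmxK [X in X^T](_ : _ = 0) ?trmx0//.
  by rewrite !trmx_mul trmxK St mulmxA.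
have -> : qform S g0 = qform S g + qform S (g0 - g).
  move: hSg gSh; rewrite -{3}(subrKC g g0); move: (g0 - g) => h hSg gSh.
  by rewrite /qform [(g + h)^T]linearD/= !mulmxDl !mulmxDr hSg gSh addr0 add0r mxE.
by rewrite lerDl.
Qed.

End QuadraticForms.

(** Expanding the nonnegative form of [A] at [v - C^-1 A^-1 v], where [C] bounds
the form of [A^-1], gives the margin [C^-1]. *)
Lemma posdef_coercive (R : realType) s (A : 'M[R]_s) : posdefmx A ->
  exists2 c, 0 < c & coercive c A.
Proof.
move=> [At Apos]; have Au : A \in unitmx by exact: posform_unit.
set B := invmx A.
have Bt : B^T = B by rewrite /B trmx_inv At.
pose M := \sum_a \sum_b `|B a b|.
have BM a b : `|B a b| <= M.
  rewrite /M (bigD1 a)//= (bigD1 b)//= -addrA lerDl addr_ge0//.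
    by rewrite sumr_ge0.
  by apply: sumr_ge0 => i _; rewrite sumr_ge0.
have M0 : 0 <= M by apply: sumr_ge0 => i _; rewrite sumr_ge0.
pose C := s%:R * M + 1.
have C0 : 0 < C by rewrite ltr_wpDl// mulr_ge0.
have BC v : qform B v <= C * sqnorm v.
  apply: le_trans (ler_norm _) _; apply: le_trans (qform_entries_le _ BM) _.
  by rewrite ler_wpM2r ?sqnorm_ge0// lerDl.
exists C^-1; first by rewrite invr_gt0.
move=> v; pose w := v - C^-1 *: (B *m v).
have w0 : 0 <= qform A w.
  have [->|/Apos/ltW//] := eqVneq w 0.
  by rewrite /qform mulmx0 mxE.
have : qform A w = qform A v - 2 * (C^-1 * sqnorm v) + C^-1 ^+ 2 * qform B v.
  have wt : w^T = v^T - C^-1 *: (v^T *m B).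
    by rewrite [LHS]linearB/= linearZ/= trmx_mul Bt.
  have ABv : A *m (B *m v) = v by rewrite mulmxA mulmxV// mul1mx.
  have vBA : v^T *m B *m A = v^T by rewrite -mulmxA mulVmx// mulmx1.
  have -> : qform A w = ((v^T - C^-1 *: (v^T *m B)) *m (A *m v - C^-1 *: v)) 0 0.
    by rewrite /qform wt -mulmxA mulmxBr -scalemxAr ABv.
  rewrite sqnormE /qform !mulmxBl !mulmxBr -!scalemxAl -!scalemxAr !mulmxA vBA.
  rewrite !mxE; ring.
move=> E; move: w0; rewrite E.
have : C^-1 ^+ 2 * qform B v <= C^-1 * sqnorm v.
  rewrite expr2 -mulrA ler_pM2l ?invr_gt0//.
  by rewrite ler_pdivrMl.
lra.
Qed.

Section Frobenius.
Variable R : realFieldType.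

Definition frob2 n s (M : 'M[R]_(n, s)) : R := \sum_i \sum_j M i j ^+ 2.

Lemma frob2_ge0 n s (M : 'M[R]_(n, s)) : 0 <= frob2 M.
Proof. by apply: sumr_ge0 => i _; apply: sumr_ge0 => j _; exact: sqr_ge0. Qed.

Lemma frob2_sqnorm n s (M : 'M[R]_(n, s)) : frob2 M = \sum_j sqnorm (col j M).
Proof.
rewrite /frob2 exchange_big; apply: eq_bigr => j _.
by apply: eq_bigr => i _; rewrite mxE.
Qed.

Lemma sqnorm_mulmx n s (M : 'M[R]_(n, s)) v :
  sqnorm (M *m v) <= frob2 M * sqnorm v.
Proof.
rewrite /frob2 mulr_suml; apply: ler_sum => i _.
by rewrite mxE; exact: cauchy_schwarz.
Qed.

Lemma entry_sqr_le_sqnorm s (v : 'cV[R]_s) a : v a 0 ^+ 2 <= sqnorm v.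
Proof.
rewrite /sqnorm (bigD1 a)//= lerDl.
by apply: sumr_ge0 => b _; exact: sqr_ge0.
Qed.

Lemma mulmx_entry_sqr_le n s q (M : 'M[R]_(n, s)) (G : 'M[R]_(s, q)) a b :
  (M *m G) a b ^+ 2 <= frob2 M * sqnorm (col b G).
Proof.
apply: le_trans (sqnorm_mulmx M (col b G)).
have -> : (M *m G) a b = (M *m col b G) a 0 by rewrite colE mulmxA -colE [RHS]mxE.
exact: entry_sqr_le_sqnorm.
Qed.

End Frobenius.

(** * Algebra of the additive model with orthogonal designs *)

Section OrthogonalDesigns.
Context (R : realType) (k n : nat) (m : 'I_k -> nat).
Variable X : forall i : 'I_k, 'M[R]_(n, m i).
Hypothesis X_orth : forall i j, i != j -> (X i)^T *m X j = 0.
Hypothesis X_unit : forall i, (X i)^T *m X i \in unitmx.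

Definition lsq i : 'M[R]_(m i, n) := invmx ((X i)^T *m X i) *m (X i)^T.

(** The orthogonal projection onto the complement of the column spaces of all
the designs, as these are mutually orthogonal. *)
Definition residmx : 'M[R]_n := 1%:M - \sum_i orth_proj (X i).

Lemma orth_projE i : orth_proj (X i) = X i *m lsq i.
Proof. by rewrite /orth_proj pinvmxE// mulmxA. Qed.

Lemma lsq_id i : lsq i *m X i = 1%:M.
Proof. by rewrite /lsq -mulmxA mulVmx. Qed.

Lemma lsq_orth i j : i != j -> lsq i *m X j = 0.
Proof. by move=> ij; rewrite /lsq -mulmxA (X_orth ij) mulmx0. Qed.

Lemma tr_lsq i : (lsq i)^T = X i *m invmx ((X i)^T *m X i).
Proof. by rewrite trmx_mul trmxK trmx_inv trmx_mul trmxK. Qed.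

Lemma lsq_gram i : lsq i *m (lsq i)^T = invmx ((X i)^T *m X i).
Proof. by rewrite tr_lsq mulmxA lsq_id mul1mx. Qed.

Lemma tr_residmx : residmx^T = residmx.
Proof.
rewrite /residmx linearB/= trmx1 linear_sum/=; congr (_ - _).
by apply: eq_bigr => i _; rewrite orth_projE trmx_mul tr_lsq /lsq !mulmxA.
Qed.

Lemma residmx_design j : residmx *m X j = 0.
Proof.
rewrite /residmx mulmxBl mul1mx mulmx_suml (bigD1 j)//= big1 => [|i ij].
  by rewrite orth_projE -mulmxA lsq_id mulmx1 addr0 subrr.
by rewrite orth_projE -mulmxA lsq_orth// mulmx0.
Qed.

(** What the residual form loses with respect to the form of [E'E] is expressed
through the least-squares images [lsq i *m E], which are small in probability. *)
Lemma qform_resid p (E : 'M[R]_(n, p)) v :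
  qform (E^T *m residmx *m E) v =
  sqnorm (E *m v) - \sum_i qform ((X i)^T *m X i) (lsq i *m E *m v).
Proof.
rewrite /residmx mulmxBr mulmxBl mulmx1 qformB qform_gram; congr (_ - _).
rewrite mulmx_sumr mulmx_suml qform_sum; apply: eq_bigr => i _.
rewrite -qform_congr; congr qform.
have lsqX : (lsq i)^T *m ((X i)^T *m X i) = X i.
  by rewrite tr_lsq -mulmxA mulVmx// mulmx1.
rewrite trmx_mul -[E^T *m (lsq i)^T *m _]mulmxA lsqX.
by rewrite orth_projE !mulmxA.
Qed.

(** The residual projection annihilates the designs, so the residual form of the
observations is that of the errors. *)
Lemma resid_additive p (B : forall i, 'M[R]_(m i, p))
    (E Y : 'M[R]_(n, p)) : Y = \sum_i X i *m B i + E ->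
  Y^T *m residmx *m Y = E^T *m residmx *m E.
Proof.
move=> YE; have QY : residmx *m Y = residmx *m E.
  rewrite YE mulmxDr mulmx_sumr big1 ?add0r// => i _.
  by rewrite mulmxA residmx_design mul0mx.
rewrite -mulmxA QY mulmxA -[Y^T *m _]trmxK trmx_mul trmxK tr_residmx QY.
by rewrite trmx_mul tr_residmx.
Qed.

Lemma lsq_additive p (B : forall i, 'M[R]_(m i, p)) (E : 'M[R]_(n, p)) i :
  lsq i *m (\sum_j X j *m B j + E) = B i + lsq i *m E.
Proof.
rewrite mulmxDr mulmx_sumr (bigD1 i)//= big1 => [|j ji].
  by rewrite mulmxA lsq_id mul1mx addr0.
by rewrite mulmxA lsq_orth ?mul0mx// eq_sym.
Qed.

End OrthogonalDesigns.

Section GLS.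
Context (R : realType) (p q : nat).
Implicit Types (S : 'M[R]_p) (Z : 'M[R]_(p, q)).

Definition gls S Z := invmx S *m Z *m invmx (Z^T *m invmx S *m Z).

Lemma gram_unit Z : \rank Z = q -> Z^T *m Z \in unitmx.
Proof.
move=> rZ; apply: posform_unit => v v0.
by rewrite qform_gram sqnorm_gt0// full_rank_mul_neq0.
Qed.

Lemma posdef_unit S : posdefmx S -> S \in unitmx.
Proof. by move=> [_ Spos]; exact: posform_unit. Qed.

Lemma gls_gram_unit S Z : posdefmx S -> \rank Z = q ->
  Z^T *m invmx S *m Z \in unitmx.
Proof.
move=> Spd rZ; have [St Spos] := Spd; have Su := posdef_unit Spd.
apply: posform_unit => v v0; rewrite qform_congr.
have -> : invmx S = (invmx S)^T *m S *m invmx S.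
  by rewrite trmx_inv St mulVmx// mul1mx.
rewrite qform_congr; apply: Spos.
apply: contra_neq (full_rank_mul_neq0 rZ v0) => SZv.
by rewrite -[Z *m v](mulKVmx Su) SZv mulmx0.
Qed.

Lemma gls_unbiased S Z : posdefmx S -> \rank Z = q -> Z^T *m gls S Z = 1%:M.
Proof. by move=> Spd rZ; rewrite /gls !mulmxA mulmxV// gls_gram_unit. Qed.

(** The weights are controlled by [S] from above and below: they minimize the form
of [S], and the ordinary least-squares weights on the right are a competitor that
does not depend on [S]. *)
Lemma sqnorm_gls_le S Z c b : posdefmx S -> \rank Z = q ->
    0 < c -> coercive c S ->
  sqnorm (col b (gls S Z)) <= c^-1 * qform S (col b (Z *m invmx (Z^T *m Z))).
Proof.
move=> Spd rZ c0 Sc; rewrite ler_pdivlMl//; apply: le_trans (Sc _) _.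
rewrite !colE; have [St Spos] := Spd.
apply: gls_minimal => //.
- exact: posdef_unit.
- move=> v; have [->|/Spos/ltW//] := eqVneq v 0.
  by rewrite /qform mulmx0 mxE.
- exact: gls_gram_unit.
- by rewrite !mulmxA mulmxV ?mul1mx// gram_unit.
Qed.

End GLS.

Section EstimationError.
Context (R : realType) (k p : nat) (m q : 'I_k -> nat).
Variable x : forall i : 'I_k, nat -> 'rV[R]_(m i).
Variable Z : forall i : 'I_k, 'M[R]_(p, q i).
Variable Theta : forall i : 'I_k, 'M[R]_(m i, q i).
Variable n : nat.
Local Notation X i := (design x i n).
Hypothesis X_orth : forall i j, i != j -> (X i)^T *m X j = 0.
Hypothesis X_unit : forall i, (X i)^T *m X i \in unitmx.
Hypothesis Z_full : forall i, \rank (Z i) = q i.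
Variable E : 'M[R]_(n, p).
Let D i := lsq (fun i => X i) i.
Let Y := \sum_(i < k) X i *m Theta i *m (Z i)^T + E.
Let S := Sigma_hat x Y.
Let r := resid_df x n.

Lemma Sigma_hatE : S = r^-1 *: (E^T *m residmx (fun i => X i) *m E).
Proof.
rewrite /S /Sigma_hat /Wmx -/(residmx (fun i => X i)) -scalemxAr -scalemxAl.
congr (_ *: _).
apply: (resid_additive X_orth X_unit (B := fun i => Theta i *m (Z i)^T)).
by rewrite /Y; congr (_ + _); apply: eq_bigr => i _; rewrite mulmxA.
Qed.

Hypothesis S_posdef : posdefmx S.

(** The estimator is exact on the systematic part because the weights are
unbiased; only the errors, projected by least squares, remain. *)
Lemma estimation_error i :
  Theta_hat x Z i Y - Theta i = D i *m E *m gls S (Z i).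
Proof.
have DY : D i *m Y = Theta i *m (Z i)^T + D i *m E.
  rewrite -(lsq_additive X_orth X_unit (fun i => Theta i *m (Z i)^T)).
  by rewrite /Y; congr (_ *m (_ + _)); apply: eq_bigr => j _; rewrite mulmxA.
have HG : Hmx x Z i Y *m Z i *m invmx ((Z i)^T *m Z i) = gls S (Z i).
  rewrite /Hmx -/S -/(gls S (Z i)) -[_ *m (Z i)^T *m Z i]mulmxA -mulmxA.
  by rewrite mulmxV ?gram_unit// mulmx1.
rewrite /Theta_hat -/(lsq (fun i => X i) i) -/(D i) DY.
rewrite -[_ *m Hmx _ _ _ _ *m _]mulmxA -[_ *m (Hmx _ _ _ _ *m _) *m _]mulmxA HG.
by rewrite mulmxDl -mulmxA gls_unbiased// mulmx1 addrAC subrr add0r.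
Qed.

Hypothesis r_gt0 : 0 < r.
(* Eventually true, since [n - r] is a sum of ranks bounded independently of [n];
   it allows the normalizations by [r] and [n] to be exchanged. *)
Hypothesis n_le : r <= n%:R <= 2 * r.

Let n_gt0 : 0 < n%:R :> R.
Proof. by have /andP[rn _] := n_le; exact: lt_le_trans rn. Qed.

Let resid_form_ge0 v : 0 <= qform (E^T *m residmx (fun i => X i) *m E) v.
Proof.
have [->|v0] := eqVneq v 0; first by rewrite /qform mulmx0 mxE.
by have := S_posdef.2 v v0; rewrite -/(qform S v) Sigma_hatE qformZ => /ltW;
  rewrite pmulr_rge0 ?invr_gt0.
Qed.

(** A lower bound [c] of [E'E / n] passes to [Sigma_hat] up to the contribution of
the least-squares images of the errors. *)
Lemma Sigma_hat_coercive c beta s :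
    (forall v, c * sqnorm v <= n%:R^-1 * sqnorm (E *m v)) ->
    (forall i a b, `|(n%:R^-1 *: ((X i)^T *m X i)) a b| <= beta) ->
    (forall i, frob2 (D i *m E) <= s) -> 0 <= beta ->
  coercive (c - (\sum_i (m i)%:R) * beta * s) S.
Proof.
move=> Ec Xb Ds b0 v; rewrite Sigma_hatE qformZ.
apply: (@le_trans _ _ (n%:R^-1 * qform (E^T *m residmx (fun i => X i) *m E) v)).
  rewrite qform_resid// mulrBr mulrBl lerB ?Ec// mulr_sumr !mulr_suml.
  apply: ler_sum => i _; rewrite -qformZ.
  apply: le_trans (ler_norm _) _; apply: le_trans (qform_entries_le _ (Xb i)) _.
  rewrite -[leRHS]mulrA ler_wpM2l ?mulr_ge0//.
  apply: le_trans (sqnorm_mulmx _ _) _.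
  by rewrite ler_wpM2r ?sqnorm_ge0.
rewrite ler_wpM2r// lef_pV2 ?posrE//.
by have /andP[] := n_le.
Qed.

Lemma Sigma_hat_upper v : qform S v <= 2 * (n%:R^-1 * frob2 E) * sqnorm v.
Proof.
rewrite Sigma_hatE qformZ.
apply: (@le_trans _ _ (2 * n%:R^-1 * qform (E^T *m residmx (fun i => X i) *m E) v)).
  rewrite ler_wpM2r// ler_pdivlMr// ler_pdivrMl// mulrC.
  by have /andP[] := n_le.
rewrite -!mulrA ler_wpM2l// ler_wpM2l ?invr_ge0//.
apply: le_trans (sqnorm_mulmx _ _).
rewrite qform_resid// gerBl; apply: sumr_ge0 => i _.
by rewrite qform_gram sqnorm_ge0.
Qed.

Lemma estimation_error_le i a b c : 0 < c -> coercive c S ->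
  ((Theta_hat x Z i Y - Theta i) a b) ^+ 2 <=
  frob2 (D i *m E) * (2 * (n%:R^-1 * frob2 E)) *
    (c^-1 * frob2 (Z i *m invmx ((Z i)^T *m Z i))).
Proof.
move=> c0 Sc; rewrite estimation_error.
apply: le_trans (mulmx_entry_sqr_le _ _ _ _) _.
rewrite -mulrA ler_wpM2l ?frob2_ge0//.
apply: le_trans (sqnorm_gls_le _ S_posdef (Z_full i) c0 Sc) _.
rewrite [leRHS]mulrCA ler_wpM2l ?invr_ge0 ?(ltW c0)//.
apply: le_trans (Sigma_hat_upper _) _.
rewrite ler_wpM2l ?mulr_ge0 ?invr_ge0 ?frob2_ge0//.
rewrite frob2_sqnorm (bigD1 b)//= lerDl.
by apply: sumr_ge0 => j _; exact: sqnorm_ge0.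
Qed.

End EstimationError.

(** * Events of probability tending to 1 *)

Section HighProbability.
Context (R : realType) (d : measure_display) (T : measurableType d).
Variable P : probability T R.
Implicit Types (A : nat -> set T) (u : nat -> R).

(** Events of probability tending to 1. Covering the complements by measurable
sets makes this stable under enlargement of the events, and meaningful for events
that quantify over all vectors, whose measurability is not obvious. *)
Definition whp A := exists B : nat -> set T,
  (\forall n \near \oo, measurable (B n) /\ ~` A n `<=` B n) /\
  P (B n) @[n --> \oo] --> 0%E.

Lemma whp_sub A A' : (\forall n \near \oo, A n `<=` A' n) -> whp A -> whp A'.
Proof.
move=> AA' [B [AB B0]]; exists B; split => //.
near=> n.
have [mB AnB] : measurable (B n) /\ ~` A n `<=` B n by near: n.
split=> //; apply: subset_trans AnB; apply: subsetC.
by near: n.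
Unshelve. all: by end_near. Qed.

Lemma whpI A A' : whp A -> whp A' -> whp (fun n => A n `&` A' n).
Proof.
move=> [B [AB B0]] [B' [AB' B'0]]; exists (fun n => B n `|` B' n); split.
  near=> n.
  have [mB AnB] : measurable (B n) /\ ~` A n `<=` B n by near: n.
  have [mB' AnB'] : measurable (B' n) /\ ~` A' n `<=` B' n by near: n.
  by split; [exact: measurableU|rewrite setCI; exact: setUSS].
apply: (@squeeze_cvge _ _ _ _ (cst 0%E) _ (fun n => P (B n) + P (B' n))%E).
- near=> n; rewrite measure_ge0/=; apply: measureU2.
    by near: n; apply: filterS AB => n [].
  by near: n; apply: filterS AB' => n [].
- exact: cvg_cst.
- by rewrite -[X in _ --> X](adde0 0%E); apply: cvgeD.
Unshelve. all: by end_near. Qed.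

Lemma whpT A : (forall n, A n = setT) -> whp A.
Proof.
move=> AT; exists (fun=> set0); split.
  by near=> n; split => //; rewrite AT setCT.
by rewrite measure0; exact: cvg_cst.
Unshelve. all: by end_near. Qed.

Lemma whp_forall (I : finType) (A : I -> nat -> set T) :
  (forall i, whp (A i)) -> whp (fun n => [set t | forall i, A i n t]).
Proof.
move=> Aw.
suff : whp (fun n => [set t | forall i, i \in enum I -> A i n t]).
  apply: whp_sub.
  by near=> n => t h i; apply: h; rewrite mem_enum.
elim: (enum I) => [|i s IH]; first by apply: whpT => n; apply/seteqP; split.
apply: whp_sub (whpI (Aw i) IH).
near=> n => t [h1 h2] j /=; by rewrite inE => /predU1P[->//|/h2].
Unshelve. all: by end_near. Qed.

Lemma whp_ae A : (\forall n \near \oo, {ae P, forall t, A n t}) -> whp A.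
Proof.
move=> aeA.
have /choice[B BP] : forall n, exists B : set T, {ae P, forall t, A n t} ->
    [/\ measurable B, P B = 0%E & ~` A n `<=` B].
  move=> n; have [[B [mB PB AB]]|nA] := pselect {ae P, forall t, A n t}.
    by exists B.
  by exists set0 => /nA.
exists B; split; first by apply: filterS aeA => n /BP[].
by apply: cvg_near_cst; apply: filterS aeA => n /BP[].
Qed.

Lemma whp_bound (C : nat -> set T) u :
  (\forall n \near \oo, measurable (C n) /\ (P (C n) <= (u n)%:E)%E) ->
  u @ \oo --> 0 -> whp (fun n => ~` C n).
Proof.
move=> CB u0; exists C; split.
  by apply: filterS CB => n [mC _]; rewrite setCK; split.
apply: (@squeeze_cvge _ _ _ _ (cst 0%E) _ (fun n => (u n)%:E)).
- by apply: filterS CB => n [_ Cu]; rewrite measure_ge0.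
- exact: cvg_cst.
- by apply: cvg_EFin => //; apply: nearW.
Qed.

Lemma whp_cvg0 (C : nat -> set T) : (forall n, measurable (C n)) ->
  whp (fun n => ~` C n) -> P (C n) @[n --> \oo] --> 0%E.
Proof.
move=> mC [B [CB B0]].
apply: (@squeeze_cvge _ _ _ _ (cst 0%E) _ (fun n => P (B n))) => //.
  apply: filterS CB => n [mB]; rewrite setCK => CBn.
  by rewrite measure_ge0/= le_measure// inE.
exact: cvg_cst.
Qed.

End HighProbability.

(** * Measurability of matrix operations *)

Section MeasurableMatrices.
Context (R : realType) (d : measure_display) (T : measurableType d).

(** Inversion is discontinuous at 0; it is written through a real power, whose
measurability is known. *)
Lemma measurable_inv : measurable_fun [set: R] (@GRing.inv R).
Proof.
have -> : @GRing.inv R = fun x => x * (x ^+ 2) `^ (-1).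
  apply/funext => x; rewrite powR_inv1 ?sqr_ge0// expr2 invfM mulrA.
  by have [->|x0] := eqVneq x 0; [rewrite invr0 mulr0|rewrite divff// mul1r].
apply: measurable_funM => //.
by apply: (measurableT_comp (measurable_powR _)) => //; exact: measurable_funX.
Qed.

Definition measurable_mx s1 s2 (M : T -> 'M[R]_(s1, s2)) :=
  forall i j, measurable_fun setT (fun t => M t i j).

Lemma measurable_mxD s1 s2 (A B : T -> 'M[R]_(s1, s2)) :
  measurable_mx A -> measurable_mx B -> measurable_mx (fun t => A t + B t).
Proof.
move=> mA mB i j; under eq_fun do rewrite mxE.
by apply: measurable_funD; [exact: mA|exact: mB].
Qed.

Lemma measurable_mulmx s1 s2 s3 (A : T -> 'M[R]_(s1, s2)) (B : T -> 'M[R]_(s2, s3)) :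
  measurable_mx A -> measurable_mx B -> measurable_mx (fun t => A t *m B t).
Proof.
move=> mA mB i j; under eq_fun do rewrite mxE.
by apply: measurable_sum => l; apply: measurable_funM; [exact: mA|exact: mB].
Qed.

Lemma measurable_trmx s1 s2 (A : T -> 'M[R]_(s1, s2)) :
  measurable_mx A -> measurable_mx (fun t => (A t)^T).
Proof. by move=> mA i j; under eq_fun do rewrite mxE; exact: mA. Qed.

Lemma measurable_det s (A : T -> 'M[R]_s) :
  measurable_mx A -> measurable_fun setT (fun t => \det (A t)).
Proof.
move=> mA; apply: measurable_sum => sigma; apply: measurable_funM => //.
by apply: measurable_prod => i _; exact: mA.
Qed.

Lemma measurable_invmx s (A : T -> 'M[R]_s) :
  measurable_mx A -> measurable_mx (fun t => invmx (A t)).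
Proof.
move=> mA i j; have mdet := measurable_det mA.
have -> : (fun t => invmx (A t) i j) = (fun t =>
    if \det (A t) == 0 then A t i j
    else (\det (A t))^-1 * cofactor (A t) j i).
  apply/funext => t; rewrite /invmx unitmxE unitfE.
  by case: eqP => _ //=; rewrite !mxE.
apply: measurable_fun_ifT; [exact: measurable_fun_eqr|exact: mA|].
apply: measurable_funM; first exact: (measurableT_comp measurable_inv).
apply: measurable_funM => //; apply: measurable_det => a b.
by under eq_fun do rewrite !mxE; exact: mA.
Qed.

End MeasurableMatrices.

(** * Shrunk products of independent identically distributed rows *)

Section Errors.
Context (R : realType) (d : measure_display) (T : measurableType d).
Context (P : probability T R) (p : nat) (e : nat -> {RV P >-> p.-tuple R}).

Lemma independent_pair i j (f g : p.-tuple R -> R) (A B : set R) :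
    mutually_independent e -> i != j ->
    measurable_fun setT f -> measurable_fun setT g ->
    measurable A -> measurable B ->
  (P ((f \o e i) @^-1` A `&` (g \o e j) @^-1` B) =
   P ((f \o e i) @^-1` A) * P ((g \o e j) @^-1` B))%E.
Proof.
move=> e_indep ij mf mg mA mB.
pose C l := if l == i then f @^-1` A else g @^-1` B.
have mC l : measurable (C l).
  rewrite /C; case: ifP => _; rewrite -[X in measurable X]setTI.
    exact: mf.
  exact: mg.
have := e_indep (i |` [fset j])%fset C mC.
rewrite big_fsetU1 ?inE// big_seq_fset1 /C eqxx eq_sym (negbTE ij) => <-.
congr (P _); apply/seteqP; split => t /=.
  move=> [fA gB] l /=; rewrite !inE => /orP[|] /eqP->; first by rewrite eqxx.
  by rewrite eq_sym (negbTE ij).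
move=> h; split.
  by have := h i; rewrite /= !inE !eqxx => /(_ isT).
by have := h j; rewrite /= !inE eqxx orbT eq_sym (negbTE ij) => /(_ isT).
Qed.

Lemma covariance_comp_indep i j (f g : p.-tuple R -> R) :
    mutually_independent e -> i != j ->
    measurable_fun setT f -> measurable_fun setT g ->
    f \o e i \in Lfun P 2%:E -> g \o e j \in Lfun P 2%:E ->
  covariance P (f \o e i) (g \o e j) = 0%E.
Proof.
move=> e_indep ij mf mg f2 g2.
pose F : {RV P >-> R} :=
  HB.pack (f \o e i) (isMeasurableFun.Build _ _ _ _ _ (Lfun_measurable f2)).
pose G : {RV P >-> R} :=
  HB.pack (g \o e j) (isMeasurableFun.Build _ _ _ _ _ (Lfun_measurable g2)).
apply: (@covariance_indep _ _ _ P F G) => // A B mA mB.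
exact: independent_pair.
Qed.

(** Equality of laws is only given on measurable sets, which is all that the
integral sees. *)
Lemma expectation_ident i j (f : p.-tuple R -> R) :
    identically_distributed e -> measurable_fun setT f ->
    f \o e i \in Lfun P 1 -> f \o e j \in Lfun P 1 ->
  ('E_P[f \o e i] = 'E_P[f \o e j])%E.
Proof.
move=> e_ident mf fi fj; rewrite unlock.
have mf' : measurable_fun setT (EFin \o f) by exact/measurable_EFinP.
rewrite -(integral_distribution mf'); last exact/Lfun1_integrable.
rewrite -(integral_distribution mf'); last exact/Lfun1_integrable.
by apply: eq_measure_integral => A mA _; exact: e_ident.
Qed.

Definition tcoord a (v : p.-tuple R) : R := tnth v a.

Lemma measurable_tcoord a : measurable_fun setT (tcoord a).
Proof. exact: measurable_tnth. Qed.

(** The weight of an error row. It is at most 1, positive, and small enough for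
large rows to make the weighted products of two coordinates bounded. *)
Definition shrink (v : p.-tuple R) : R := (1 + \sum_a tcoord a v ^+ 2)^-1.

Lemma shrink_den_gt0 v : 0 < 1 + \sum_a tcoord a v ^+ 2.
Proof. by rewrite ltr_wpDr// sumr_ge0// => a _; exact: sqr_ge0. Qed.

Lemma shrink_gt0 v : 0 < shrink v.
Proof. by rewrite invr_gt0 shrink_den_gt0. Qed.

Lemma shrink_le1 v : shrink v <= 1.
Proof.
rewrite invf_le1 ?shrink_den_gt0// lerDl.
by apply: sumr_ge0 => a _; exact: sqr_ge0.
Qed.

Lemma measurable_shrink : measurable_fun setT shrink.
Proof.
apply: (measurableT_comp (@measurable_inv R)); apply: measurable_funD => //.
by apply: measurable_sum => a; apply: measurable_funX; exact: measurable_tcoord.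
Qed.

Definition shrunk_prod a b v : R := tcoord a v * tcoord b v * shrink v.

Lemma measurable_shrunk_prod a b : measurable_fun setT (shrunk_prod a b).
Proof.
apply: measurable_funM; last exact: measurable_shrink.
by apply: measurable_funM; exact: measurable_tcoord.
Qed.

Lemma shrunk_prod_le1 a b v : `|shrunk_prod a b v| <= 1.
Proof.
rewrite /shrunk_prod normrM (gtr0_norm (shrink_gt0 v)).
rewrite ler_pdivrMr ?shrink_den_gt0// mul1r normrM.
have sq c : `|tcoord c v| ^+ 2 <= \sum_a tcoord a v ^+ 2.
  rewrite real_normK ?num_real// (bigD1 c)//= lerDl.
  by apply: sumr_ge0 => i _; exact: sqr_ge0.
have := sq a; have := sq b.
move: (\sum_a _) `|_| `|_| => s x y; have := sqr_ge0 (x - y); nra.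
Qed.

Lemma shrunk_prod_Lfun2 a b j : shrunk_prod a b \o e j \in Lfun P 2%:E.
Proof.
apply: (@bounded_Lfun2 _ _ _ _ _ 1); last by move=> t; exact: shrunk_prod_le1.
by apply: measurableT_comp => //; exact: measurable_shrunk_prod.
Qed.

Definition shrunk_cov : 'M[R]_p :=
  \matrix_(a, b) fine 'E_P[shrunk_prod a b \o e 0].

Lemma expectation_shrunk_prod a b j : identically_distributed e ->
  ('E_P[shrunk_prod a b \o e j] = (shrunk_cov a b)%:E)%E.
Proof.
move=> e_ident; rewrite mxE fineK; last first.
  by rewrite expectation_fin_num// Lfun2_Lfun1// shrunk_prod_Lfun2.
apply: expectation_ident => //; first exact: measurable_shrunk_prod.
  exact/Lfun2_Lfun1/shrunk_prod_Lfun2.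
exact/Lfun2_Lfun1/shrunk_prod_Lfun2.
Qed.

Section Moments.
Variables (j : nat) (Sigma : 'M[R]_p).
Hypothesis e_moments : mean_cov (e j) 0 Sigma.

Lemma tcoord_Lfun2 a : tcoord a \o e j \in Lfun P 2%:E.
Proof. by have [+ _ _] := e_moments; exact. Qed.

Lemma expectation_tcoord a : ('E_P[tcoord a \o e j] = 0)%E.
Proof. by have [_ + _] := e_moments => /(_ a); rewrite mxE. Qed.

Lemma variance_tcoord a : ('V_P[tcoord a \o e j] = (Sigma a a)%:E)%E.
Proof. by have [_ _] := e_moments; exact. Qed.

Lemma expectation_tcoordM a b :
  ('E_P[(tcoord a \o e j) \* (tcoord b \o e j)] = (Sigma a b)%:E)%E.
Proof.
have [_ _ <-] := e_moments.
rewrite [RHS](@covarianceE _ _ _ P (tcoord a \o e j) (tcoord b \o e j)).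
- by rewrite expectation_tcoord mul0e sube0.
- exact/Lfun2_Lfun1/tcoord_Lfun2.
- exact/Lfun2_Lfun1/tcoord_Lfun2.
- by apply: Lfun2_mul_Lfun1; exact: tcoord_Lfun2.
Qed.

Definition dotv (v : 'cV[R]_p) (y : p.-tuple R) : R := \sum_a tcoord a y * v a 0.

Lemma dotv_sqrE v y :
  dotv v y ^+ 2 = \sum_(ab : 'I_p * 'I_p)
    (v ab.1 0 * v ab.2 0) * (tcoord ab.1 y * tcoord ab.2 y).
Proof.
rewrite expr2 /dotv big_distrlr/= pair_bigA/=.
by apply: eq_bigr => ab _; ring.
Qed.

Lemma measurable_dotv v : measurable_fun setT (dotv v).
Proof.
by apply: measurable_sum => a; apply: measurable_funM => //; exact: measurable_tcoord.
Qed.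

Lemma expectation_dotv_sqr v :
  ('E_P[fun t => (dotv v (e j t) ^+ 2)%R] = (qform Sigma v)%:E)%E.
Proof.
under [X in expectation _ X]eq_fun do rewrite dotv_sqrE.
rewrite (@expectation_lincomb _ _ _ P _ (fun ab t =>
   (tcoord ab.1 (e j t) * tcoord ab.2 (e j t))) _ (fun ab => Sigma ab.1 ab.2)).
- congr EFin; rewrite qformE pair_bigA/=.
  by apply: eq_bigr => ab _; ring.
- by move=> ab; apply: Lfun2_mul_Lfun1; exact: tcoord_Lfun2.
- by move=> ab; exact: expectation_tcoordM.
Qed.

End Moments.

Lemma expectation_shrunk_dotv_sqr v :
  ('E_P[fun t => (dotv v (e 0 t) ^+ 2 * shrink (e 0 t))%R] =
   (qform shrunk_cov v)%:E)%E.
Proof.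
under [X in expectation _ X]eq_fun => t.
  rewrite dotv_sqrE mulr_suml.
  under eq_bigr do rewrite -mulrA -/(shrunk_prod _ _ _).
  over.
rewrite (@expectation_lincomb _ _ _ P _ (fun ab t => shrunk_prod ab.1 ab.2 (e 0 t))
  _ (fun ab => shrunk_cov ab.1 ab.2)).
- congr EFin; rewrite qformE pair_bigA/=.
  by apply: eq_bigr => ab _; ring.
- by move=> ab; exact/Lfun2_Lfun1/shrunk_prod_Lfun2.
- move=> ab; rewrite mxE fineK//.
  by rewrite expectation_fin_num// Lfun2_Lfun1// shrunk_prod_Lfun2.
Qed.

Lemma expectation_eq0 (X : T -> R) : measurable_fun setT X ->
  (forall t, 0 <= X t) ->
  ('E_P[X] = 0)%E <-> ae_eq P setT (EFin \o X) (cst 0%E).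
Proof.
move=> mX X0; rewrite unlock.
rewrite -(@ae_eq_integral_abs _ _ _ P setT measurableT (EFin \o X)); last first.
  exact/measurable_EFinP.
by under [X in _ <-> X = _]eq_integral do rewrite /= ger0_norm//.
Qed.

(** If the form vanished at [v], then [dotv v e ^ 2] times a positive weight would
have expectation 0, so [dotv v e] would vanish almost surely, against the
positive definiteness of [Sigma]. *)
Lemma shrunk_cov_posdef Sigma : mean_cov (e 0) 0 Sigma -> posdefmx Sigma ->
  posdefmx shrunk_cov.
Proof.
move=> e_moments [_ Spos]; split.
  by apply/matrixP => a b; rewrite !mxE; congr (fine (expectation _ _));
    apply/funext => t /=; rewrite /shrunk_prod (mulrC (tcoord b _)).
have mdotv v : measurable_fun setT (dotv v \o e 0).
  by apply: measurableT_comp => //; exact: measurable_dotv.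
move=> v v0; rewrite -/(qform shrunk_cov v) lt_def.
have -> : 0 <= qform shrunk_cov v.
  rewrite -lee_fin -expectation_shrunk_dotv_sqr expectation_ge0// => t.
  by rewrite mulr_ge0 ?sqr_ge0// ltW// shrink_gt0.
rewrite andbT.
apply: contraTN (Spos v v0) => /eqP q0; rewrite -leNgt -/(qform Sigma v).
have : ('E_P[fun t => (dotv v (e 0 t) ^+ 2 * shrink (e 0 t))%R] = 0)%E.
  by rewrite expectation_shrunk_dotv_sqr q0.
rewrite expectation_eq0; last first.
- by move=> t; rewrite mulr_ge0 ?sqr_ge0// ltW// shrink_gt0.
- apply: measurable_funM; first exact: (measurable_funX 2 (mdotv v)).
  by apply: measurableT_comp => //; exact: measurable_shrink.
move=> ae0; rewrite -lee_fin -(expectation_dotv_sqr e_moments).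
suff -> : ('E_P[fun t => (dotv v (e 0 t) ^+ 2)%R] = 0)%E by [].
apply/expectation_eq0.
- exact: (measurable_funX 2 (mdotv v)).
- by move=> t; exact: sqr_ge0.
apply: filterS ae0 => t /(_ I)/= [] /eqP.
by rewrite mulf_eq0 (gt_eqF (shrink_gt0 _)) orbF => /eqP ->.
Qed.

End Errors.

(** * Asymptotic control of the error matrix *)

Lemma cvg_invr_sqrtn (R : realType) (K : R) :
  (K / Num.sqrt n%:R) @[n --> \oo] --> 0.
Proof.
have inv0 : n%:R^-1 @[n --> \oo] --> (0 : R).
  apply/gtr0_cvgV0; last exact: cvgr_idn.
  by near=> n; rewrite ltr0n; near: n; exact: nbhs_infty_gt.
rewrite -(mulr0 K); apply: cvgMr.
under eq_fun do rewrite -sqrtrV//.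
by rewrite -sqrtr0; apply: (cvg_comp _ _ inv0); exact: sqrt_continuous.
Unshelve. all: by end_near. Qed.

Lemma measurable_superlevel (R : realType) (d : measure_display)
    (T : measurableType d) (X : T -> R) (c : R) :
  measurable_fun setT X -> measurable [set t | c <= X t].
Proof.
move=> mX; rewrite -[X in measurable X]setTI.
by have := measurable_fun_ler (measurable_cst c) mX;
  move=> /(_ measurableT [set true]); exact.
Qed.

Section Events.
Context (R : realType) (d : measure_display) (T : measurableType d).
Context (P : probability T R) (p : nat) (e : nat -> {RV P >-> p.-tuple R}).
Variable Sigma : 'M[R]_p.
Hypothesis e_indep : mutually_independent e.
Hypothesis e_ident : identically_distributed e.
Hypothesis e_moments : forall j, mean_cov (e j) 0 Sigma.

Lemma measurable_errors n : measurable_mx (errors e n).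
Proof.
move=> j a; under eq_fun do rewrite mxE.
by apply: (measurableT_comp (measurable_tcoord a)).
Qed.

Lemma measurable_frob2 s1 s2 (M : T -> 'M[R]_(s1, s2)) :
  measurable_mx M -> measurable_fun setT (fun t => frob2 (M t)).
Proof.
move=> mM; apply: measurable_sum => i; apply: measurable_sum => j.
by apply: measurable_funX; exact: mM.
Qed.

(** The expectation of the left-hand side is the trace of [Sigma]; any bound
tending to infinity with [n] would do, and [sqrt n] is the one that compensates
the rate of [whp_frob2_lincomb]. *)
Lemma whp_frob2_errors :
  whp P (fun n => [set t | n%:R^-1 * frob2 (errors e n t) <= Num.sqrt n%:R]).
Proof.
pose C n := [set t | Num.sqrt n%:R <= n%:R^-1 * frob2 (errors e n t)].
apply: (@whp_sub _ _ _ _ (fun n => ~` C n)).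
  by near=> n => t /= /negP; rewrite -ltNge => /ltW.
apply: (@whp_bound _ _ _ _ C (fun n => \tr Sigma / Num.sqrt n%:R)); last first.
  exact: cvg_invr_sqrtn.
near=> n.
have n0 : 0 < n%:R :> R by rewrite ltr0n; near: n; exact: nbhs_infty_gt.
have mX : measurable_fun setT (fun t => n%:R^-1 * frob2 (errors e n t)).
  by apply: measurable_funM => //; exact/measurable_frob2/measurable_errors.
split; first exact: measurable_superlevel.
apply: le_trans (markov_ge0 _ _ _ _) _ => //.
- by rewrite sqrtr_gt0.
- by move=> t; rewrite mulr_ge0 ?frob2_ge0// invr_ge0 ltW.
rewrite mulrC EFinM lee_wpmul2l ?lee_fin ?invr_ge0 ?sqrtr_ge0//.
under [X in expectation _ X]eq_fun => t.
  rewrite /frob2 pair_bigA/= mulr_sumr.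
  under eq_bigr do rewrite mxE.
  over.
rewrite (@expectation_lincomb _ _ _ P _ (fun (ja : 'I_n * 'I_p) t =>
   tcoord ja.2 (e ja.1 t) ^+ 2) (fun=> n%:R^-1) (fun ja => Sigma ja.2 ja.2)).
- rewrite lee_fin -mulr_sumr -(pair_bigA _ (fun _ a => Sigma a a))/=.
  by rewrite sumr_const card_ord -/(\tr Sigma) -[\tr Sigma *+ n]mulr_natl mulKf// gt_eqF.
- by move=> ja; apply: Lfun2_mul_Lfun1; exact: (tcoord_Lfun2 (e_moments _)).
- by move=> ja; exact: (expectation_tcoordM (e_moments _)).
Unshelve. all: by end_near. Qed.

Lemma cov_diag_ge0 a : 0 <= Sigma a a.
Proof. by rewrite -lee_fin -(variance_tcoord (e_moments 0%N)) variance_ge0. Qed.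

Lemma prob_lincomb_errors_le n b (u : 'I_n -> R) eta : 0 < eta ->
  (P [set t | (eta <= `|\sum_j u j * errors e n t j b|)%R] <=
   (Sigma b b * (\sum_j u j ^+ 2) / eta ^+ 2)%:E)%E.
Proof.
move=> eta0.
have Y2 (j : 'I_n) := tcoord_Lfun2 (e_moments j) b.
have Y0 (i j : 'I_n) : i != j ->
    covariance P (tcoord b \o e i) (tcoord b \o e j) = 0%E.
  by move=> ij; apply: covariance_comp_indep => //; exact: measurable_tcoord.
have YV (j : 'I_n) : ('V_P[tcoord b \o e j] <= (Sigma b b)%:E)%E.
  by rewrite (variance_tcoord (e_moments j)).
have YE (j : 'I_n) : ('E_P[tcoord b \o e j] = (0 : R)%:E)%E.
  exact: expectation_tcoord (e_moments j) b.
have := chebyshev_lincomb u Y2 Y0 YV (index_enum_uniq _) eta0 YE.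
congr (P _ <= _)%E; apply: eq_set => t; congr (eta <= `|_|).
rewrite [X in _ - X]big1 ?subr0 => [|j _]; last by rewrite mulr0.
by apply: eq_bigr => j _; rewrite mxE.
Qed.

(** The entries of [D n *m errors e n t] have variance of order [1 / n], so their
squares are in probability below any rate slower than [1 / n]. *)
Lemma whp_frob2_lincomb m (D : forall n, 'M[R]_(m, n)) K s :
    0 <= K -> 0 < s ->
    (\forall n \near \oo, forall a, (D n *m (D n)^T) a a <= K / n%:R) ->
  whp P (fun n => [set t | frob2 (D n *m errors e n t) <= s / Num.sqrt n%:R]).
Proof.
move=> K0 s0 DK.
pose N : R := (m * p)%:R + 1.
have N0 : 0 < N by rewrite ltr_wpDl.
pose s' := s / N.
have s'0 : 0 < s' by rewrite divr_gt0.
pose W n := [set t | forall ab : 'I_m * 'I_p,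
  (D n *m errors e n t) ab.1 ab.2 ^+ 2 <= s' / Num.sqrt n%:R].
apply: (@whp_sub _ _ _ _ W).
  near=> n => t /= tW; rewrite /frob2 pair_bigA/=.
  apply: le_trans (ler_sum _ (fun ab _ => tW ab)) _.
  rewrite sumr_const card_prod !card_ord -[leLHS]mulr_natl mulrA.
  rewrite ler_wpM2r ?invr_ge0 ?sqrtr_ge0//.
  by rewrite /s' mulrCA ger_pMr// ler_pdivrMr// mul1r lerDl.
apply: whp_forall => -[a b] /=.
pose eta n := Num.sqrt (s' / Num.sqrt n%:R).
pose C n := [set t | eta n <= `|(D n *m errors e n t) a b|].
apply: (@whp_sub _ _ _ _ (fun n => ~` C n)).
  near=> n => t /= /negP; rewrite -ltNge => h.
  rewrite -[X in _ <= X]sqr_sqrtr; last exact: divr_ge0 (ltW s'0) (sqrtr_ge0 _).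
  by rewrite -real_normK ?num_real// ler_sqr ?nnegrE ?sqrtr_ge0// ltW.
apply: (@whp_bound _ _ _ _ C (fun n => (Sigma b b * K / s') / Num.sqrt n%:R));
  last exact: cvg_invr_sqrtn.
near=> n.
have n0 : 0 < n%:R :> R by rewrite ltr0n; near: n; exact: nbhs_infty_gt.
have sn0 : 0 < Num.sqrt n%:R :> R by rewrite sqrtr_gt0.
have mDE : measurable_fun setT (fun t => (D n *m errors e n t) a b).
  by apply: measurable_mulmx => //; exact: measurable_errors.
split; first by apply: measurable_superlevel; exact: measurableT_comp.
have -> : C n = [set t | eta n <= `|\sum_j D n a j * errors e n t j b|].
  by apply/seteqP; split=> t; rewrite /C /= mxE.
apply: le_trans (prob_lincomb_errors_le _ _ _) _.
  by rewrite sqrtr_gt0 divr_gt0.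
rewrite lee_fin sqr_sqrtr; last exact: divr_ge0 (ltW s'0) (sqrtr_ge0 _).
have -> : \sum_j D n a j ^+ 2 = (D n *m (D n)^T) a a.
  by rewrite mxE; apply: eq_bigr => j _; rewrite mxE expr2.
have DKn : (D n *m (D n)^T) a a <= K / n%:R.
  by move: a {C mDE eta}; near: n.
apply: (@le_trans _ _ (Sigma b b * (K / n%:R) / (s' / Num.sqrt n%:R))).
  rewrite ler_wpM2r//.
    by rewrite invr_ge0; exact: divr_ge0 (ltW s'0) (sqrtr_ge0 _).
  by rewrite ler_wpM2l// cov_diag_ge0.
rewrite le_eqVlt; apply/orP; left; apply/eqP.
rewrite -[in n%:R^-1](sqr_sqrtr (ltW n0)).
by field; rewrite !gt_eqF.
Unshelve. all: by end_near. Qed.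

(** Shrinking decreases the form of [E'E / n], and the averages of the shrunk
products converge in probability to [shrunk_cov], being bounded and uncorrelated
across rows. *)
Lemma whp_errors_coercive : posdefmx Sigma -> exists2 c, 0 < c &
  whp P (fun n => [set t | forall v,
    c * sqnorm v <= n%:R^-1 * sqnorm (errors e n t *m v)]).
Proof.
move=> Sigma_pos.
have [c c0 Wc] := posdef_coercive (shrunk_cov_posdef (e_moments 0%N) Sigma_pos).
exists (c / 2); first by rewrite divr_gt0.
(* An entrywise error [delta] changes the form by at most [p * delta], which has
   to leave half of the margin [c]. *)
pose delta := c / 2 / (p%:R + 1).
have delta0 : 0 < delta by rewrite !divr_gt0// ltr_wpDl.
pose What n t : 'M[R]_p :=
  \matrix_(a, b) \sum_(j < n) n%:R^-1 * shrunk_prod a b (e j t).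
pose W n := [set t | forall ab : 'I_p * 'I_p,
  `|What n t ab.1 ab.2 - shrunk_cov e ab.1 ab.2| <= delta].
apply: (@whp_sub _ _ _ _ W).
  near=> n => t /= tW v.
  have n0 : 0 < n%:R :> R by rewrite ltr0n; near: n; exact: nbhs_infty_gt.
  have := coercive_perturb Wc (fun a b => tW (a, b)) v.
  move=> h; apply: le_trans (le_trans _ h) _.
    have pd : p%:R * delta <= c / 2.
      rewrite /delta mulrCA ger_pMr ?divr_gt0// ler_pdivrMr ?ltr_wpDl//.
      by rewrite mul1r lerDl.
    by rewrite ler_wpM2r ?sqnorm_ge0//; lra.
  have -> : qform (What n t) v =
      n%:R^-1 * \sum_(j < n) dotv v (e j t) ^+ 2 * shrink (e j t).
    rewrite qformE mulr_sumr.
    under [RHS]eq_bigr do rewrite dotv_sqrE mulr_suml mulr_sumr.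
    rewrite [RHS]exchange_big/= pair_bigA/=; apply: eq_bigr => ab _.
    rewrite mxE mulr_sumr mulr_suml; apply: eq_bigr => j _.
    rewrite /shrunk_prod; ring.
  rewrite ler_wpM2l ?invr_ge0 ?(ltW n0)// /sqnorm; apply: ler_sum => j _.
  have -> : (errors e n t *m v) j 0 = dotv v (e j t).
    by rewrite mxE; apply: eq_bigr => a _; rewrite mxE.
  by rewrite ler_piMr ?sqr_ge0// shrink_le1.
apply: whp_forall => -[a b] /=.
pose C n := [set t | delta <= `|What n t a b - shrunk_cov e a b|].
apply: (@whp_sub _ _ _ _ (fun n => ~` C n)).
  by near=> n => t /= /negP; rewrite -ltNge => /ltW.
apply: (@whp_bound _ _ _ _ C (fun n => (delta ^+ 2)^-1 / Num.sqrt n%:R));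
  last exact: cvg_invr_sqrtn.
near=> n.
have n1 : 1 <= n%:R :> R by rewrite ler1n; near: n; exact: nbhs_infty_gt.
have n0 : 0 < n%:R :> R by exact: lt_le_trans n1.
have mf j : measurable_fun setT (shrunk_prod a b \o e j).
  by apply: measurableT_comp => //; exact: measurable_shrunk_prod.
have mW : measurable_fun setT (fun t => What n t a b - shrunk_cov e a b).
  apply: measurable_funB => //; under eq_fun do rewrite mxE.
  by apply: measurable_sum => j; apply: measurable_funM => //; exact: mf.
split; first by apply: measurable_superlevel; exact: measurableT_comp.
have Y2 (j : 'I_n) := shrunk_prod_Lfun2 e a b j.
have Y0 (i j : 'I_n) : i != j ->
    covariance P (shrunk_prod a b \o e i) (shrunk_prod a b \o e j) = 0%E.
  by move=> ij; apply: covariance_comp_indep => //; exact: measurable_shrunk_prod.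
have YV (j : 'I_n) : ('V_P[shrunk_prod a b \o e j] <= 1%:E)%E.
  by apply: bounded_variance_le1 => // t; exact: shrunk_prod_le1.
have YE (j : 'I_n) := expectation_shrunk_prod a b j e_ident.
have -> : C n = [set t | delta <=
    `|\sum_(j < n) n%:R^-1 * (shrunk_prod a b \o e j) t -
      \sum_(j < n) n%:R^-1 * shrunk_cov e a b|].
  apply: eq_set => t; rewrite mxE; congr (delta <= `|_ - _|).
  by rewrite sumr_const card_ord -[_ * _ *+ n]mulr_natl mulVKf// gt_eqF.
apply: le_trans (chebyshev_lincomb _ Y2 Y0 YV (index_enum_uniq _) delta0 YE) _.
rewrite lee_fin mul1r sumr_const card_ord -[_ ^+ 2 *+ n]mulr_natl expr2 mulrA.
rewrite divff ?gt_eqF// mul1r mulrC.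
rewrite ler_wpM2l ?invr_ge0 ?sqr_ge0// lef_pV2 ?posrE ?sqrtr_gt0//.
rewrite -[X in _ <= X](sqr_sqrtr (ltW n0)) expr2 ler_peMl ?sqrtr_ge0//.
by rewrite -[leLHS](sqrtr1 R) ler_sqrt.
Unshelve. all: by end_near. Qed.

End Events.

(** * Limits of matrices and consistency *)

Lemma mx_entry_le_norm (R : realType) s1 s2 (M : 'M[R]_(s1, s2)) i j :
  `|M i j| <= `|M|.
Proof. by rewrite [leRHS]mx_normrE; exact: (le_bigmax _ _ (i, j)). Qed.

Lemma mx_norm_lt (R : realType) s1 s2 (M : 'M[R]_(s1, s2)) eps : 0 < eps ->
  (forall i j, `|M i j| < eps) -> `|M| < eps.
Proof.
move=> eps0 Me; have [M0|/mx_norm_neq0[ij Mij]] := eqVneq (mx_norm M) 0.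
  by rewrite [ltLHS]M0.
by rewrite [ltLHS]Mij.
Qed.

Lemma measurable_mx_norm (R : realType) (d : measure_display)
    (T : measurableType d) s1 s2 (M : T -> 'M[R]_(s1, s2)) :
  measurable_mx M -> measurable_fun setT (fun t => `|M t|).
Proof.
move=> mM.
have -> : (fun t => `|M t|) = fun t => \big[Num.max/0]_ij `|M t ij.1 ij.2|.
  by apply/funext => t; exact: mx_normrE.
elim: (index_enum _) => [|ij s IH].
  by under eq_fun do rewrite big_nil; exact: measurable_cst.
under eq_fun do rewrite big_cons.
apply: measurable_maxr => //.
by apply: measurableT_comp => //; exact: mM.
Qed.

Lemma near_coercive (R : realType) s (A : nat -> 'M[R]_s) (L : 'M[R]_s) :
    A n @[n --> \oo] --> L -> posdefmx L ->
  exists2 c, 0 < c & \forall n \near \oo, coercive c (A n).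
Proof.
move=> AL /posdef_coercive[c c0 Lc]; exists (c / 2); first exact: divr_gt0.
pose delta := c / 2 / (s%:R + 1).
have delta0 : 0 < delta by rewrite !divr_gt0// ltr_wpDl.
have sd : s%:R * delta <= c / 2.
  rewrite /delta mulrCA ger_pMr ?divr_gt0// ler_pdivrMr ?ltr_wpDl//.
  by rewrite mul1r lerDl.
move/cvgrPdist_le : AL => /(_ _ delta0); apply: filterS => n An v.
have AnL a b : `|A n a b - L a b| <= delta.
  apply: le_trans An; rewrite distrC.
  by have := mx_entry_le_norm (L - A n) a b; rewrite !mxE.
apply: le_trans (coercive_perturb Lc AnL v).
by rewrite ler_wpM2r ?sqnorm_ge0//; lra.
Qed.

Lemma near_entries_le (R : realType) s (A : nat -> 'M[R]_s) (L : 'M[R]_s) :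
    A n @[n --> \oo] --> L ->
  \forall n \near \oo, forall a b, `|A n a b| <= `|L| + 1.
Proof.
move/cvgrPdist_le => /(_ 1 ltr01); apply: filterS => n An a b.
apply: le_trans (mx_entry_le_norm _ _ _) _.
rewrite -[A n](subrK L) addrC; apply: le_trans (ler_normD _ _) _.
by rewrite lerD2l distrC.
Qed.

Section Measurability.
Context (R : realType) (d : measure_display) (T : measurableType d).
Context (k p : nat) (m q : 'I_k -> nat).
Variable x : forall i : 'I_k, nat -> 'rV[R]_(m i).
Variable Z : forall i : 'I_k, 'M[R]_(p, q i).

Lemma measurable_Theta_hat n (Y : T -> 'M[R]_(n, p)) i :
  measurable_mx Y -> measurable_mx (fun t => Theta_hat x Z i (Y t)).
Proof.
move=> mY; rewrite /Theta_hat /Hmx /Sigma_hat.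
have mS : measurable_mx (fun t => invmx ((Y t)^T *m Wmx x n *m Y t)).
  apply: measurable_invmx; apply: measurable_mulmx => //.
  by apply: measurable_mulmx => //; exact: measurable_trmx.
do 2![apply: measurable_mulmx => //].
apply: measurable_mulmx; first exact: measurable_mulmx.
apply: measurable_mulmx => //; apply: measurable_mulmx.
  exact: measurable_mulmx.
apply: measurable_invmx; apply: measurable_mulmx => //.
exact: measurable_mulmx.
Qed.

End Measurability.

Section Consistency.
Context (R : realType) (k : nat) (m : 'I_k -> nat).
Variable x : forall i : 'I_k, nat -> 'rV[R]_(m i).

(** The ranks are bounded by the numbers of columns, so [resid_df x n] is [n] up to
a bounded term. *)
Lemma near_resid_df : \forall n \near \oo,
  0 < resid_df x n /\ resid_df x n <= n%:R <= 2 * resid_df x n.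
Proof.
near=> n.
pose r := (\sum_(i < k) \rank (design x i n))%N.
have rE : resid_df x n = n%:R - r%:R by rewrite /resid_df /r natr_sum.
have rM : (r <= \sum_(i < k) m i)%N by apply: leq_sum => i _; exact: rank_leq_col.
have nM : ((\sum_(i < k) m i).*2 < n)%N by near: n; exact: nbhs_infty_gt.
have rn : (r.*2 < n)%N by apply: leq_ltn_trans nM; rewrite leq_double.
have : (r.*2)%:R < n%:R :> R by rewrite ltr_nat.
rewrite -mul2n natrM rE; have : 0 <= r%:R :> R by [].
by split; [|apply/andP; split]; lra.
Unshelve. all: by end_near. Qed.

End Consistency.

Theorem theorem3p3 (R : realType) (d : measure_display) (T : measurableType d)
    (P : probability T R) (k p : nat) (m q : 'I_k -> nat)
    (x : forall i : 'I_k, nat -> 'rV[R]_(m i))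
    (Z : forall i : 'I_k, 'M[R]_(p, q i))
    (Theta : forall i : 'I_k, 'M[R]_(m i, q i))
    (e : nat -> {RV P >-> p.-tuple R}) (Sigma : 'M[R]_p)
    (Rlim : forall i : 'I_k, 'M[R]_(m i))
    (n0 : nat)
    (Z_size : forall i, (q i < p)%N)
    (Z_full : forall i, \rank (Z i) = q i)
    (X_size : forall n, (n0 <= n)%N -> forall i, (m i < n)%N)
    (X_full : forall n, (n0 <= n)%N -> forall i, \rank (design x i n) = m i)
    (X_rank : forall n, (n0 <= n)%N ->
       forall i, (\rank (design x i n) + p <= n)%N)
    (X_orth : forall n, (n0 <= n)%N -> forall i j, i != j ->
       (design x i n)^T *m design x j n = 0)
    (Sigma_pos : posdefmx Sigma)
    (e_indep : mutually_independent e)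
    (e_ident : identically_distributed e)
    (e_moments : forall j, mean_cov (e j) 0 Sigma)
    (e_cont : forall n, (n0 <= n)%N -> continuous_type P (errors e n))
    (Sigma_hat_pos : forall n, (n0 <= n)%N ->
       {ae P, forall t, posdefmx (Sigma_hat x (observations x Z Theta e n t))})
    (Rlim_pos : forall l, posdefmx (Rlim l))
    (X_lim : forall l,
       n%:R^-1 *: ((design x l n)^T *m design x l n) @[n --> \oo] --> Rlim l)
    (i : 'I_k) :
  cvg_in_probability P
    (fun n t => Theta_hat x Z i (observations x Z Theta e n t)) (Theta i).
Proof.
move=> eps eps0.
pose D n l := lsq (fun i => design x i n) l.
have gram_coercive l : exists2 c, 0 < c & \forall n \near \oo,
    coercive (n%:R * c) ((design x l n)^T *m design x l n).
  have [c c0 Ac] := near_coercive (X_lim l) (Rlim_pos l).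
  exists c => //; near=> n => v.
  have n_gt0 : 0 < n%:R :> R by rewrite ltr0n; near: n; exact: nbhs_infty_gt.
  have := near Ac n _ v; rewrite qformZ -mulrA => h.
  by rewrite -ler_pdivlMl// h.
have gram_unit : \forall n \near \oo, forall l,
    (design x l n)^T *m design x l n \in unitmx.
  apply: filter_forall => l; have [c c0 Xc] := gram_coercive l; near=> n.
  apply: (@coercive_unit _ _ (n%:R * c)); last by near: n.
  by rewrite mulr_gt0// ltr0n; near: n; exact: nbhs_infty_gt.
have lsq_gram_le l : exists2 K, 0 <= K & \forall n \near \oo,
    forall a, (D n l *m (D n l)^T) a a <= K / n%:R.
  have [c c0 Xc] := gram_coercive l.
  exists c^-1; first by rewrite invr_ge0 ltW.
  near=> n => a; rewrite /D lsq_gram; last by near: n.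
  rewrite -invfM mulrC; apply: invmx_diag_le.
    by rewrite mulr_gt0// ltr0n; near: n; exact: nbhs_infty_gt.
  by near: n.
pose beta := \sum_l (`|Rlim l| + 1).
have beta0 : 0 <= beta by apply: sumr_ge0 => l _; rewrite addr_ge0.
have gram_le : \forall n \near \oo, forall l a b,
    `|(n%:R^-1 *: ((design x l n)^T *m design x l n)) a b| <= beta.
  apply: filter_forall => l; apply: filterS (near_entries_le (X_lim l)).
  move=> n Xb a b; apply: le_trans (Xb a b) _.
  by rewrite /beta (bigD1 l)//= lerDl; apply: sumr_ge0 => j _; rewrite addr_ge0.
have [c c0 Ec] := whp_errors_coercive e_indep e_ident e_moments Sigma_pos.
pose M : R := (\sum_l (m l)%:R) * beta.
have M0 : 0 <= M by rewrite mulr_ge0// sumr_ge0.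
pose K := frob2 (Z i *m invmx ((Z i)^T *m Z i)).
have K0 : 0 <= K := frob2_ge0 _.
(* The first bound keeps half of the margin [c] in [Sigma_hat], the second makes
   the final estimate [4 * s * K / c] of the squared error less than [eps ^ 2]. *)
pose s := Num.min (c / 2 / (M + 1)) (eps ^+ 2 * c / (8 * (K + 1))).
have s0 : 0 < s.
  rewrite lt_min !divr_gt0 ?mulr_gt0 ?exprn_gt0// ltr_wpDl//.
have Ms : M * s <= c / 2.
  have : s <= c / 2 / (M + 1) by rewrite ge_min lexx.
  rewrite ler_pdivlMr ?ltr_wpDl// => h; nra.
have Ks : 4 * s * K < eps ^+ 2 * c.
  have : s <= eps ^+ 2 * c / (8 * (K + 1)) by rewrite ge_min lexx orbT.
  rewrite ler_pdivlMr ?mulr_gt0 ?ltr_wpDl// => h; nra.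
apply: whp_cvg0 => [n|].
  apply: measurable_superlevel; apply: measurable_mx_norm.
  apply: measurable_mxD => //; apply: measurable_Theta_hat.
  by apply: measurable_mxD => //; exact: measurable_errors.
have DEs : whp P (fun n => [set t |
    forall l, frob2 (D n l *m errors e n t) <= s / Num.sqrt n%:R]).
  apply: whp_forall => l; have [C C0 DC] := lsq_gram_le l.
  exact: (whp_frob2_lincomb e_indep e_moments C0 s0 DC).
have Spos : whp P (fun n => [set t |
    posdefmx (Sigma_hat x (observations x Z Theta e n t))]).
  by apply: whp_ae; near=> n; apply: Sigma_hat_pos; near: n; exact: nbhs_infty_ge.
apply: whp_sub (whpI (whpI Spos DEs) (whpI (whp_frob2_errors e_moments) Ec)).
near=> n => t [[Sp DE] [Es Ev]] /=; apply/negP; rewrite -ltNge.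
have n_ge1 : 1 <= n%:R :> R by rewrite ler1n; near: n; exact: nbhs_infty_gt.
have sn_ge1 : 1 <= Num.sqrt n%:R :> R.
  by rewrite -[leLHS](sqrtr1 R) ler_sqrt// (le_trans ler01).
have sn_gt0 : 0 < Num.sqrt n%:R :> R := lt_le_trans ltr01 sn_ge1.
have orth : forall i j, i != j -> (design x i n)^T *m design x j n = 0.
  by apply: X_orth; near: n; exact: nbhs_infty_ge.
have unit : forall l, (design x l n)^T *m design x l n \in unitmx by near: n.
have [r0 rn] : 0 < resid_df x n /\ resid_df x n <= n%:R <= 2 * resid_df x n.
  by near: n; exact: near_resid_df.
have DEs' l : frob2 (D n l *m errors e n t) <= s.
  by apply: le_trans (DE l) _; rewrite ler_pdivrMr// ler_peMr// ltW.
have Sc : coercive (c / 2) (Sigma_hat x (observations x Z Theta e n t)).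
  have := Sigma_hat_coercive orth unit Sp r0 rn Ev _ DEs' beta0.
  move=> h v; apply: le_trans (h _ v); last by near: n.
  by rewrite ler_wpM2r ?sqnorm_ge0// -/M; lra.
apply: mx_norm_lt => // a b.
rewrite -ltr_sqr ?nnegrE ?(ltW eps0)// real_normK ?num_real//.
have c2 : 0 < c / 2 by exact: divr_gt0.
have err : (Theta_hat x Z i (observations x Z Theta e n t) - Theta i) a b ^+ 2
    <= frob2 (D n i *m errors e n t) * (2 * (n%:R^-1 * frob2 (errors e n t))) *
      ((c / 2)^-1 * K) :=
  estimation_error_le orth unit Z_full Sp r0 rn a b c2 Sc.
apply: le_lt_trans err _.
apply: (@le_lt_trans _ _ (s / Num.sqrt n%:R * (2 * Num.sqrt n%:R) * ((c / 2)^-1 * K))).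
  rewrite ler_wpM2r ?mulr_ge0 ?invr_ge0 ?divr_ge0 ?(ltW c0)//.
  apply: ler_pM; rewrite ?frob2_ge0 ?mulr_ge0 ?invr_ge0 ?frob2_ge0//.
  by rewrite ler_pM2l.
have -> : s / Num.sqrt n%:R * (2 * Num.sqrt n%:R) * ((c / 2)^-1 * K) = 4 * s * K / c.
  by field; rewrite !gt_eqF.
by rewrite ltr_pdivrMr.
Unshelve. all: by end_near. Qed.
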